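(* Let $g:\mathbb{R}^m\to\mathbb{R}$ be a (not necessarily convex) Fréchet differentiable function whose gradient is $L_g$-Lipschitz continuous ($L_g\ge 0$), and assume $g$ is bounded from below. Let $\alpha>0$, $\beta\in(0,1)$, $0<s<\frac{2(1-\beta)}{L_g}$, and let $(x_n)_{n\in\mathbb{N}}$, $(y_n)_{n\in\mathbb{N}}$ be the sequences generated from a starting point $x_0=y_0\in\mathbb{R}^m$ by $$x_{n+1}=y_n-s\nabla g(y_n)\ (n\ge 0),\qquad y_n=x_n+\frac{\beta n}{n+\alpha}(x_n-x_{n-1})\ (n\ge 1).$$ Assume that $(x_n)_{n\in\mathbb{N}}$ is bounded, let $\overline{x}\in\operatorname{crit}(g)$ be such that $\lim_{n\to+\infty}x_n=\overline{x}$, and suppose that $$H:\mathbb{R}^m\times\mathbb{R}^m\to\mathbb{R},\quad H(x,y)=g(x)+\frac12\|x-y\|^2$$ fulfills the Łojasiewicz property at $(\overline{x},\overline{x})\in\operatorname{crit} H$ with Łojasiewicz exponent $\theta\in\left(\frac12,1\right)$. Then there exist $b_1,b_2,b_3,b_4>0$ and $\overline{N}_1\in\mathbb{N}$ such that: (b$_1$) $g(y_n)-g(\overline{x})\le b_1\frac{1}{n^{\frac{1}{2\theta-1}}}$ for all $n\ge\overline{N}_1+2$; (b$_2$) $g(x_n)-g(\overline{x})\le b_2\frac{1}{n^{\frac{1}{2\theta-1}}}$ for all $n\ge\overline{N}_1+2$; (b$_3$) $\|x_n-\overline{x}\|\le b_3\frac{1}{n^{\frac{1-\theta}{2\theta-1}}}$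 for all $n\ge\overline{N}_1+2$; (b$_4$) $\|y_n-\overline{x}\|\le b_4\frac{1}{n^{\frac{1-\theta}{2\theta-1}}}$ for all $n>\overline{N}_1+2$.
   Context: $\|\cdot\|$ is the Euclidean norm; $\mathbb{N}=\{0,1,2,\dots\}$; $\operatorname{crit} f=\{x:\nabla f(x)=0\}$ for a differentiable function $f$. ''$L_g$-Lipschitz continuous gradient'' means $\|\nabla g(x)-\nabla g(y)\|\le L_g\|x-y\|$ for all $x,y$. The condition $0<s<\frac{2(1-\beta)}{L_g}$ is read as $s>0$ and $sL_g<2(1-\beta)$ (so when $L_g=0$ any $s>0$ is allowed). Łojasiewicz property: a differentiable function $f:\mathbb{R}^k\to\mathbb{R}$ fulfills the Łojasiewicz property at $\overline{z}\in\operatorname{crit} f$ with Łojasiewicz exponent $\theta\in(0,1)$ if there exist $K,\epsilon>0$ such that $|f(z)-f(\overline{z})|^\theta\le K\|\nabla f(z)\|$ for every $z$ with $\|z-\overline{z}\|<\epsilon$. (Applied to $H$ with $\mathbb{R}^m\times\mathbb{R}^m\cong\mathbb{R}^{2m}$.) *)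

(* Defs.v *)
From HB Require Import structures.
From mathcomp Require Import all_boot all_order all_algebra.
From mathcomp Require Import all_classical all_reals all_analysis.

Set Implicit Arguments.
Unset Strict Implicit.
Unset Printing Implicit Defensive.

Import Order.TTheory GRing.Theory Num.Theory.
Import numFieldNormedType.Exports.

Local Open Scope classical_set_scope.
Local Open Scope ring_scope.

(* R^k is the type 'rV[R]_k of row vectors.

   The library's norm `|v| on 'rV[R]_k is the sup norm, so the Euclidean norm
   is introduced separately.  The two norms are equivalent in finite dimension:
   the library's convergence and Fréchet differentiability on 'rV[R]_k are
   those of the Euclidean norm. *)
Definition enorm (R : realType) (k : nat) (v : 'rV[R]_k) : R :=
  Num.sqrt (\sum_(i < k) v ord0 i ^+ 2).

Definition gradient (R : realType) (k : nat) (f : 'rV[R]_k -> R)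
    (x : 'rV[R]_k) : 'rV[R]_k :=
  \row_(i < k) 'D_(delta_mx ord0 i) f x.

(* Only meaningful when f is differentiable, since 'D_v is a total operator. *)
Definition crit (R : realType) (k : nat) (f : 'rV[R]_k -> R) :
    set 'rV[R]_k :=
  [set x | gradient f x = 0].

Definition lojasiewicz_at (R : realType) (k : nat) (f : 'rV[R]_k -> R)
    (zbar : 'rV[R]_k) (theta : R) : Prop :=
  [/\ forall z, differentiable f z,
      crit f zbar,
      0 < theta < 1 &
      exists K eps : R, [/\ 0 < K, 0 < eps &
        forall z, enorm (z - zbar) < eps ->
          `|f z - f zbar| `^ theta <= K * enorm (gradient f z)]].

(* The function (x, y) |-> g(x) + |x - y|^2 / 2, where the pair (x, y) in
   R^m x R^m is the row vector [row_mx x y] in R^(m + m). *)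
Definition regularization (R : realType) (m : nat) (g : 'rV[R]_m -> R)
    (z : 'rV[R]_(m + m)) : R :=
  g (lsubmx z) + 2^-1 * enorm (lsubmx z - rsubmx z) ^+ 2.

(* Main.v *)
Require Import Defs.
From HB Require Import structures.
From mathcomp Require Import all_boot all_order all_algebra.
From mathcomp Require Import all_classical all_reals all_analysis.
From mathcomp Require Import ring lra.
Import Order.TTheory GRing.Theory Num.Theory.
Import numFieldNormedType.Exports.
Local Open Scope classical_set_scope.
Local Open Scope ring_scope.

(* Write d_n = x_n - x_(n-1) and E_n = g(y_n) + w |d_n|^2.  The descent lemma
   for g bounds E_(n+1) - E_n by a quadratic form in (d_(n+1), d_n); for the
   right weight w this form is negative definite in the limit exactly when
   s Lg < 2 (1 - beta), hence eventually
     c (|d_(n+1)|^2 + |d_n|^2) <= E_n - E_(n+1).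
   Moreover E_n = H(y_n, y_n + sqrt(2w) d_n), and the gradient of H at that
   point is O(|d_(n+1)| + |d_n|), so the Lojasiewicz inequality gives
     r_n^theta <= C (|d_(n+1)| + |d_n|) for r_n = E_n - g(xbar).
   Both inequalities together give r_n - r_(n+1) >= k r_n^(2 theta), whence
   the rate of r_n by telescoping r_n^(1 - 2 theta); telescoping
   r_n^(1 - theta) bounds the length of the tail of (x_n) by r_n^(1 - theta). *)

(** * Euclidean inner product and norm on row vectors *)

Section Euclidean.
Context {R : realType} {k : nat}.
Implicit Types (a : R) (u v w : 'rV[R]_k).

Definition dot u v : R := \sum_(i < k) u ord0 i * v ord0 i.

Lemma dotC u v : dot u v = dot v u.
Proof. by apply: eq_bigr => i _; rewrite mulrC. Qed.

Lemma dotDl u v w : dot (u + v) w = dot u w + dot v w.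
Proof. by rewrite -big_split; apply: eq_bigr => i _; rewrite mxE mulrDl. Qed.

Lemma dotZl a u v : dot (a *: u) v = a * dot u v.
Proof. by rewrite /dot big_distrr; apply: eq_bigr => i _; rewrite mxE -mulrA. Qed.

Lemma dotNl u v : dot (- u) v = - dot u v.
Proof. by rewrite -scaleN1r dotZl mulN1r. Qed.

Lemma dotDr u v w : dot u (v + w) = dot u v + dot u w.
Proof. by rewrite dotC dotDl dotC (dotC w). Qed.

Lemma dotZr a u v : dot u (a *: v) = a * dot u v.
Proof. by rewrite dotC dotZl dotC. Qed.

Lemma dotNr u v : dot u (- v) = - dot u v.
Proof. by rewrite dotC dotNl dotC. Qed.

Definition dotE := (dotDl, dotDr, dotNl, dotNr, dotZl, dotZr).

Lemma dot_delta i u : dot (delta_mx ord0 i) u = u ord0 i.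
Proof.
rewrite /dot (bigD1 i)//= mxE !eqxx mul1r big1 ?addr0// => j ji.
by rewrite mxE eqxx (negPf ji) mul0r.
Qed.

Lemma enorm_sqr u : enorm u ^+ 2 = dot u u.
Proof.
rewrite sqr_sqrtr; first by apply: eq_bigr => i _; rewrite expr2.
by apply: sumr_ge0 => i _; rewrite sqr_ge0.
Qed.

Lemma enorm_ge0 u : 0 <= enorm u. Proof. exact: sqrtr_ge0. Qed.

Lemma dot_ge0 u : 0 <= dot u u. Proof. by rewrite -enorm_sqr sqr_ge0. Qed.

Lemma dot0l u : dot 0 u = 0.
Proof. by rewrite -(scale0r 0) dotZl mul0r. Qed.

Lemma enorm_eq0 u : enorm u = 0 -> u = 0.
Proof.
move=> u0; apply/rowP => i; rewrite mxE.
have := enorm_sqr u; rewrite u0 expr0n/= => /esym/eqP.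
rewrite psumr_eq0 => [/allP/(_ i (mem_index_enum _))|j _].
  by rewrite mulf_eq0 orbb => /eqP.
by rewrite -expr2 sqr_ge0.
Qed.

(** Cauchy-Schwarz: the square of [enorm v *: u - enorm u *: v] expands to twice the product of
    [enorm u * enorm v] with the gap of the inequality, and the nonzero factor is divided out. *)
Lemma dot_le_enormM u v : dot u v <= enorm u * enorm v.
Proof.
have [/enorm_eq0->|u0] := eqVneq (enorm u) 0.
  by rewrite dot0l mulr_ge0 ?enorm_ge0.
have [/enorm_eq0->|v0] := eqVneq (enorm v) 0.
  by rewrite dotC dot0l mulr_ge0 ?enorm_ge0.
have up : 0 < enorm u by rewrite lt_def u0 enorm_ge0.
have vp : 0 < enorm v by rewrite lt_def v0 enorm_ge0.
have := dot_ge0 (enorm v *: u - enorm u *: v).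
rewrite !dotE (dotC v u) -!enorm_sqr => h.
have : 0 <= (enorm u * enorm v) * (enorm u * enorm v - dot u v) by lra.
by rewrite pmulr_rge0 ?mulr_gt0// subr_ge0.
Qed.

Lemma enormZ a u : enorm (a *: u) = `|a| * enorm u.
Proof.
apply/eqP; rewrite -(@eqrXn2 _ 2) ?mulr_ge0 ?enorm_ge0//; apply/eqP.
rewrite enorm_sqr exprMn enorm_sqr !dotE.
by rewrite real_normK ?num_real// mulrA expr2.
Qed.

Lemma enorm0 : enorm (0 : 'rV[R]_k) = 0.
Proof. by rewrite -(scale0r 0) enormZ normr0 mul0r. Qed.

Lemma enormN u : enorm (- u) = enorm u.
Proof. by rewrite -scaleN1r enormZ normrN1 mul1r. Qed.

Lemma ler_enormD u v : enorm (u + v) <= enorm u + enorm v.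
Proof.
rewrite -(@ler_pXn2r _ 2)// ?nnegrE ?addr_ge0 ?enorm_ge0//.
rewrite enorm_sqr !dotE (dotC v u) sqrrD -!enorm_sqr.
have := dot_le_enormM u v; lra.
Qed.

Lemma ler_enormB u v : enorm (u - v) <= enorm u + enorm v.
Proof. by rewrite -(enormN v) ler_enormD. Qed.

(** Limits are taken in the sup norm; this comparison carries them over to the Euclidean norm. *)
Lemma enorm_le_norm u : enorm u <= Num.sqrt k%:R * `|u|.
Proof.
rewrite -[`|u|]ger0_norm// -sqrtr_sqr -sqrtrM ?ler0n// ler_wsqrtr//.
apply: le_trans (_ : \sum_(i < k) `|u| ^+ 2 <= _); last first.
  by rewrite sumr_const card_ord mulr_natl.
apply: ler_sum => i _; rewrite -real_normK ?num_real//.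
rewrite ler_pXn2r ?nnegrE//.
rewrite [leRHS]mx_normrE.
exact: (le_bigmax_cond _ (fun ij => `|u ij.1 ij.2|) (j := (ord0, i))).
Qed.

End Euclidean.

Lemma enorm_row_mx {R : realType} {k l : nat} (u : 'rV[R]_k) (v : 'rV[R]_l) :
  enorm (row_mx u v) <= enorm u + enorm v.
Proof.
rewrite -(@ler_pXn2r _ 2)// ?nnegrE ?addr_ge0 ?enorm_ge0//.
have -> : enorm (row_mx u v) ^+ 2 = enorm u ^+ 2 + enorm v ^+ 2.
  rewrite !enorm_sqr /dot big_split_ord/=.
  by congr +%R; apply: eq_bigr => i _; rewrite ?row_mxEl ?row_mxEr.
have := mulr_ge0 (enorm_ge0 u) (enorm_ge0 v); lra.
Qed.

(** * Directional derivatives and the descent lemma *)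

Section Gradient.
Context {R : realType} {k : nat}.
Implicit Types (g : 'rV[R]_k -> R) (u v : 'rV[R]_k).

Lemma derive_gradient g u v : differentiable g u ->
  'D_v g u = dot (gradient g u) v.
Proof.
move=> gu; rewrite deriveE// {1}(row_sum_delta v) linear_sum.
apply: eq_bigr => i _; rewrite linearZ/= mxE deriveE// mulrC.
by [].
Qed.

Lemma is_derive_line g u v (t : R) : differentiable g (u + t *: v) ->
  is_derive t (1 : R) (fun t => g (u + t *: v)) (dot (gradient g (u + t *: v)) v).
Proof.
move=> gd; rewrite -derive_gradient//.
(* Along the line, the difference quotients are those of [g] in direction [v] at [u + t *: v]. *)
have E : (fun h : R => h^-1 *: (g (u + (h *: 1 + t) *: v) - g (u + t *: v))) =
         (fun h : R => h^-1 *: (g (h *: v + (u + t *: v)) - g (u + t *: v))).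
  by apply/funext => h; rewrite scalerDl [h *: 1]mulr1 addrCA.
split; last by rewrite /derive/= E.
by rewrite /derivable/= E; exact: diff_derivable.
Qed.

(** Subtracting the linear and quadratic terms along the segment leaves a function [phi] whose
    derivative is nonpositive by Cauchy-Schwarz and the Lipschitz bound; compare its values at 1 and
    0. *)
Lemma descent_lemma g L u v : (forall z, differentiable g z) ->
  (forall z w, enorm (gradient g z - gradient g w) <= L * enorm (z - w)) ->
  g (u + v) <= g u + dot (gradient g u) v + L / 2 * dot v v.
Proof.
move=> gd gL.
pose phi (t : R) := g (u + t *: v) - dot (gradient g u) v * t
  - L / 2 * dot v v * (t * t).
have dphi (t : R) : is_derive t (1 : R) phi (dot (gradient g (u + t *: v)) v
    - dot (gradient g u) v - L * dot v v * t).
  have dg := @is_derive_line g u v t (gd _).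
  rewrite /phi; apply: is_derive_eq.
  rewrite /GRing.scale/=; lra.
have : phi 1 <= phi 0.
  apply: (@ler0_derive1_nincr _ phi 0 1) => //.
  - move=> t; rewrite in_itv/= => /andP[t0 _].
    rewrite derive1E derive_val.
    have := dot_le_enormM (gradient g (u + t *: v) - gradient g u) v.
    have := gL (u + t *: v) u.
    rewrite addrAC subrr add0r enormZ ger0_norm ?(ltW t0)// !dotE.
    move/(ler_wpM2r (enorm_ge0 v)).
    rewrite -enorm_sqr; lra.
  - apply: continuous_subspaceT => t.
    by apply: differentiable_continuous; apply/derivable1_diffP.
rewrite /phi scale1r scale0r addr0; lra.
Qed.

End Gradient.
Arguments dot : simpl never.

(** * Gradient of the regularized function on the product space *)

Section Regularization.
Context {R : realType} {m : nat} (g : 'rV[R]_m -> R).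
Context (g_diff : forall z, differentiable g z).

Lemma is_derive_regularization (z v : 'rV[R]_(m + m)) :
  is_derive z v (regularization g)
    (dot (gradient g (lsubmx z)) (lsubmx v) +
     dot (lsubmx z - rsubmx z) (lsubmx v - rsubmx v)).
Proof.
rewrite -derive_gradient//.
pose Q (z : 'rV[R]_(m + m)) := 2^-1 * enorm (lsubmx z - rsubmx z) ^+ 2.
have dl : is_derive z v (g \o lsubmx) ('D_(lsubmx v) g (lsubmx z)).
  have E : (fun h : R => h^-1 *: (g (lsubmx (h *: v + z)) - g (lsubmx z))) =
      (fun h => h^-1 *: (g (h *: lsubmx v + lsubmx z) - g (lsubmx z))).
    by apply/funext => h; rewrite linearP.
  split; last by rewrite /derive/= E.
  by rewrite /derivable/= E; exact: diff_derivable.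
suff dQ : is_derive z v Q (dot (lsubmx z - rsubmx z) (lsubmx v - rsubmx v)).
  exact: is_deriveD.
set W := lsubmx z - rsubmx z; set w := lsubmx v - rsubmx v.
(* [Q] is quadratic, so for [h != 0] its difference quotient is exactly
   [dot W w + h / 2 * dot w w]. *)
have lim : (fun h : R => h^-1 *: (Q (h *: v + z) - Q z)) @ 0^' --> dot W w.
  have : (fun h : R => dot W w + h / 2 * dot w w) @ 0^' --> dot W w.
    rewrite -[X in _ --> X]addr0 -[X in _ --> _ + X](mul0r (dot w w)).
    apply: cvgD; first exact: cvg_cst.
    apply: cvgMr_tmp; rewrite -[X in _ --> X](mul0r 2^-1).
    by apply: cvgMr_tmp; apply: nbhs_dnbhs; exact: cvg_id.
  apply: cvg_trans; apply: near_eq_cvg; near=> h.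
  have h0 : h != 0 by near: h; exact: nbhs_dnbhs_neq.
  have E : lsubmx (h *: v + z) - rsubmx (h *: v + z) = h *: w + W.
    by apply/rowP => i; rewrite !mxE; lra.
  rewrite /Q E.
  rewrite -/W !enorm_sqr; clearbody W w.
  rewrite !dotE (dotC w W) /GRing.scale/=; field.
  exact: h0.
split; last exact: cvg_lim lim.
exact: cvgP lim.
Unshelve. all: by end_near. Qed.

Lemma gradient_regularization (u v : 'rV[R]_m) :
  gradient (regularization g) (row_mx u v) =
  row_mx (gradient g u + (u - v)) (v - u).
Proof.
apply/rowP => i; rewrite mxE.
have /@derive_val -> := is_derive_regularization (row_mx u v) (delta_mx ord0 i).
rewrite row_mxKl row_mxKr -[i]splitK; case: fintype.splitP => j _ /=.
  have -> : lsubmx (delta_mx ord0 (lshift m j)) = delta_mx ord0 j :> 'rV[R]_m.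
    by apply/rowP => l; rewrite !mxE eq_lshift.
  have -> : rsubmx (delta_mx ord0 (lshift m j)) = 0 :> 'rV[R]_m.
    by apply/rowP => l; rewrite !mxE eq_rlshift.
  by rewrite row_mxEl subr0 ![dot _ (delta_mx _ _)]dotC !dot_delta !mxE.
have -> : rsubmx (delta_mx ord0 (rshift m j)) = delta_mx ord0 j :> 'rV[R]_m.
  by apply/rowP => l; rewrite !mxE eq_rshift.
have -> : lsubmx (delta_mx ord0 (rshift m j)) = 0 :> 'rV[R]_m.
  by apply/rowP => l; rewrite !mxE eq_lrshift.
rewrite row_mxEr sub0r dotNr ![dot _ (delta_mx _ _)]dotC dot_delta.
by rewrite dotC dot0l add0r !mxE opprB.
Qed.

End Regularization.

(** * Power inequalities and convergence rates of real sequences *)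

Section ScalarRates.
Context {R : realType}.
Implicit Types (a b q t p c C theta : R) (r e : nat -> R).

Lemma powR_le_tangent t q : 0 <= t -> 0 < q < 1 -> t `^ q <= 1 + q * (t - 1).
Proof.
move=> t0 /andP[q0 q1].
have p0 : 0 < 1 - q by rewrite subr_gt0.
have := @conjugate_powR _ (t `^ q) 1 q^-1 (1 - q)^-1 (powR_ge0 _ _) ler01.
rewrite !invr_gt0 !invrK => /(_ q0 p0 (subrKC _ _)).
rewrite -powRrM mulfV ?gt_eqF// powRr1// powR1 mulr1 mul1r.
lra.
Qed.

(** Convexity at 1: exp(q ln t) >= 1 + q ln t, and ln t <= t - 1 is multiplied by q <= 0. *)
Lemma powR_ge_tangent t q : 0 < t -> q <= 0 -> 1 + q * (t - 1) <= t `^ q.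
Proof.
move=> t0 q0; rewrite /powR gt_eqF//.
apply: le_trans (expR_ge1Dx _); rewrite lerD2l ler_wnM2l//.
by rewrite lerBrDl -[leRHS](lnK t0) expR_ge1Dx.
Qed.

Lemma powR_sub_ge a b q : 0 < a -> 0 <= b -> 0 < q < 1 ->
  q * a `^ (q - 1) * (a - b) <= a `^ q - b `^ q.
Proof.
move=> a0 b0 q01.
have t0 : 0 <= b / a by rewrite divr_ge0// ltW.
have := powR_le_tangent _ _ t0 q01.
have -> : b `^ q = a `^ q * (b / a) `^ q.
  by rewrite -powRM ?(ltW a0)// mulrC divfK ?gt_eqF.
have -> : a `^ (q - 1) = a `^ q / a.
  by rewrite powRB ?powRr1 ?(ltW a0)// (gt_eqF a0) implybT.
move=> h.
have aq : 0 < a `^ q by exact: powR_gt0.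
move/(ler_wpM2l (ltW aq)) : h.
have -> : a `^ q * (1 + q * (b / a - 1)) = a `^ q - q * (a `^ q / a) * (a - b).
  by field; rewrite gt_eqF.
lra.
Qed.

Lemma powR_sub_le a b q : 0 < a -> 0 < b -> q <= 0 ->
  - q * a `^ (q - 1) * (a - b) <= b `^ q - a `^ q.
Proof.
move=> a0 b0 q0.
have t0 : 0 < b / a by rewrite divr_gt0.
have := powR_ge_tangent _ _ t0 q0.
have -> : b `^ q = a `^ q * (b / a) `^ q.
  by rewrite -powRM ?(ltW a0) ?(ltW t0)// mulrC divfK ?gt_eqF.
have -> : a `^ (q - 1) = a `^ q / a.
  by rewrite powRB ?powRr1 ?(ltW a0)// (gt_eqF a0) implybT.
move=> h.
have aq : 0 < a `^ q by exact: powR_gt0.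
move/(ler_wpM2l (ltW aq)) : h.
have -> : a `^ q * (1 + q * (b / a - 1)) = a `^ q - q * (a `^ q / a) * (a - b).
  by field; rewrite gt_eqF.
lra.
Qed.

(** Discrete analogue of r' <= - c r^p: the power r^(1 - p) grows at least linearly from index N on.
    Since n > 2 N gives n - N >= n / 2, the growth can be stated in n itself, which is the factor
    1/2 in [K]. *)
Lemma sublinear_rate r c p N : 0 < c -> 1 < p ->
  (forall n, (N <= n)%N -> 0 <= r n) ->
  (forall n, (N <= n)%N -> c * r n `^ p <= r n - r n.+1) ->
  exists2 b, 0 < b &
    forall n, (2 * N < n)%N -> r n <= b * n%:R `^ (- (p - 1)^-1).
Proof.
move=> c0 p1 r0 rS.
have p10 : 0 < p - 1 by rewrite subr_gt0.
pose K := (p - 1) * c / 2.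
have K0 : 0 < K by rewrite divr_gt0// mulr_gt0.
exists (K `^ (- (p - 1)^-1)); first exact: powR_gt0.
move=> n nN.
have n0 : 0 < n%:R :> R by rewrite ltr0n (leq_ltn_trans _ nN).
have Nn : (N <= n)%N by rewrite (leq_trans _ (ltnW nN))// mul2n -addnn leq_addr.
have := r0 n Nn; rewrite le_eqVlt => /predU1P[<-|rn0].
  by rewrite mulr_ge0 ?powR_ge0.
rewrite -powRM ?(ltW K0) ?(ltW n0)//.
(* [r] is nonincreasing from N on, so [r n > 0] makes all earlier terms positive and negative powers
   are meaningful up to n. *)
have rpos k : (N + k <= n)%N -> 0 < r (N + k)%N.
  move=> kn; rewrite (lt_le_trans rn0)//.
  have -> : n = (N + k + (n - (N + k)))%N by rewrite subnKC.
  elim: (n - _)%N => [|j ih]; first by rewrite addn0.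
  rewrite (le_trans _ ih)// addnS -subr_ge0 (le_trans _ (rS _ _))//.
    by rewrite mulr_ge0 ?powR_ge0 ?ltW.
  by rewrite -addnA leq_addr.
(* By convexity r^(1 - p) increases by at least (p - 1) c at each step. *)
have key k : (N + k <= n)%N -> (p - 1) * c * k%:R <= r (N + k)%N `^ (1 - p).
  elim: k => [|k ih] kn; first by rewrite mulr0 powR_ge0.
  have kn' : (N + k <= n)%N by rewrite (leq_trans _ kn)// leq_add2l.
  have := powR_sub_le _ _ (1 - p) (rpos _ kn') (rpos _ kn).
  have -> : 1 - p <= 0 by lra.
  move=> /(_ isT).
  have {}/ih := kn'.
  have := rS (N + k)%N (leq_addr _ _).
  rewrite -addnS -natr1 opprB (_ : 1 - p - 1 = - p); last by lra.
  set a := r (N + k)%N; set b := r _; rewrite powRN.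
  have a0 : 0 < a `^ p by apply: powR_gt0; exact: rpos.
  rewrite -ler_pdivlMr// => h1 h2 h3.
  have : (p - 1) * c <= (p - 1) * (a `^ p)^-1 * (a - b).
    by rewrite -mulrA ler_pM2l// [leRHS]mulrC.
  lra.
have h : K * n%:R <= r n `^ (1 - p).
  have := key (n - N)%N; rewrite subnKC// leqnn => /(_ isT); apply: le_trans.
  have : 2 * N%:R <= n%:R :> R by rewrite -natrM ler_nat ltnW.
  have M0 : 0 <= (p - 1) * c by rewrite mulr_ge0 ?ltW.
  move/(ler_wpM2l M0); rewrite natrB// /K; lra.
have Kn0 : 0 < K * n%:R by rewrite mulr_gt0.
have rE : r n = (r n `^ (1 - p)) `^ (- (p - 1)^-1).
  rewrite -powRrM (_ : _ * _ = 1) ?powRr1 ?(ltW rn0)//.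
  by field; rewrite gt_eqF.
rewrite rE !powRN lef_pV2 ?posrE ?powR_gt0//.
by rewrite ge0_ler_powR ?nnegrE ?invr_ge0 ?powR_ge0 ?(ltW Kn0) ?(ltW p10).
Qed.

Lemma kl_descent_rate r e c C theta N : 2^-1 < theta < 1 -> 0 < c -> 0 < C ->
  (forall n, 0 <= e n) ->
  (forall n, (N <= n)%N -> 0 <= r n) ->
  (forall n, (N <= n)%N -> c * (e n.+1 ^+ 2 + e n ^+ 2) <= r n - r n.+1) ->
  (forall n, (N <= n)%N -> r n `^ theta <= C * (e n.+1 + e n)) ->
  exists2 b, 0 < b &
    forall n, (2 * N < n)%N -> r n <= b * n%:R `^ (- (2 * theta - 1)^-1).
Proof.
move=> /andP[th2 th1] c0 C0 e0 r0 rS rKL.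
(* Here p = 2 theta > 1. Squaring the Lojasiewicz bound and using (a + b)^2 <= 2 (a^2 + b^2)
   produces the factor 2 C^2. *)
apply: (@sublinear_rate r (c / (2 * C ^+ 2))) => //.
- by rewrite divr_gt0// mulr_gt0// exprn_gt0.
- by lra.
move=> n Nn; apply: le_trans (rS _ Nn).
have := rKL _ Nn; rewrite -(@ler_pXn2r _ 2)// ?nnegrE ?powR_ge0//; last first.
  by rewrite mulr_ge0 ?addr_ge0 ?(ltW C0).
have -> : (r n `^ theta) ^+ 2 = r n `^ (2 * theta).
  by rewrite [2 * _]mulrC powRrM -powR_mulrn ?powR_ge0.
move=> h.
rewrite mulrAC ler_pdivrMr ?mulr_gt0 ?exprn_gt0//.
rewrite -mulrA ler_pM2l//; apply: le_trans h _.
have := sqr_ge0 (e n.+1 - e n).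
move/(ler_wpM2l (sqr_ge0 C)); lra.
Qed.

(** With S = e_(n+1) + e_n, concavity of t^(1 - theta) bounds the difference of powers below by (1 -
    theta) r_n^(- theta) (r_n - r_(n+1)). Descent gives r_n - r_(n+1) >= c S^2 / 2 and r_n^theta <=
    C S, so one factor S cancels. *)
Lemma kl_descent_length r e c C theta N : 0 < theta < 1 -> 0 < c -> 0 < C ->
  (forall n, 0 <= e n) ->
  (forall n, (N <= n)%N -> 0 <= r n) ->
  (forall n, (N <= n)%N -> c * (e n.+1 ^+ 2 + e n ^+ 2) <= r n - r n.+1) ->
  (forall n, (N <= n)%N -> r n `^ theta <= C * (e n.+1 + e n)) ->
  forall n, (N <= n)%N -> (1 - theta) * (c / (2 * C)) * (e n.+1 + e n) <=
    r n `^ (1 - theta) - r n.+1 `^ (1 - theta).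
Proof.
move=> /andP[th0 th1] c0 C0 e0 r0 rS rKL n Nn.
have Nn1 : (N <= n.+1)%N by exact: leqW.
have q0 : 0 < 1 - theta < 1 by lra.
have S2 : c / 2 * (e n.+1 + e n) ^+ 2 <= r n - r n.+1.
  apply: le_trans (rS _ Nn).
  rewrite -mulrA ler_pM2l//; have := sqr_ge0 (e n.+1 - e n); lra.
have := r0 _ Nn; rewrite le_eqVlt => /predU1P[rn0|rn0].
  have S0 : e n.+1 + e n = 0.
    apply/eqP; rewrite -sqrf_eq0 eq_le sqr_ge0 andbT.
    rewrite -(@pmulr_rle0 _ (c / 2)) ?divr_gt0//.
    by apply: le_trans S2 _; rewrite -rn0 sub0r oppr_le0 r0.
  rewrite S0 mulr0 -rn0.
  suff -> : r n.+1 = 0 by rewrite subrr.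
  apply/eqP; rewrite eq_le r0// andbT.
  by move: S2; rewrite S0 -rn0 expr0n mulr0 sub0r oppr_ge0.
have := powR_sub_ge _ _ _ rn0 (r0 _ Nn1) q0; apply: le_trans.
have -> : 1 - theta - 1 = - theta by lra.
rewrite -!mulrA ler_pM2l ?subr_gt0// powRN.
have rt : 0 < r n `^ theta by exact: powR_gt0.
rewrite ler_pdivlMl//.
set S := e n.+1 + e n in S2 *.
have S0 : 0 <= S by rewrite addr_ge0.
apply: le_trans S2.
apply: le_trans (ler_wpM2r _ (rKL _ Nn)) _.
  by rewrite !mulr_ge0 ?invr_ge0 ?mulr_ge0 ?(ltW c0) ?(ltW C0).
by rewrite -/S le_eqVlt; apply/orP; left; apply/eqP; field; rewrite gt_eqF.
Qed.

(** Transfers a rate from an index to its successor, since n + 2 <= 2 (n + 1). *)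
Lemma powR_succ_le n q : 0 <= q ->
  n.+1%:R `^ (- q) <= 2 `^ q * n.+2%:R `^ (- q) :> R.
Proof.
move=> q0; rewrite !powRN mulrC -[leRHS]invrK invfM invrK.
rewrite lef_pV2 ?posrE ?divr_gt0 ?powR_gt0//.
rewrite ler_pdivrMr ?powR_gt0// -powRM//.
rewrite ge0_ler_powR ?nnegrE ?mulr_ge0// -natrM ler_nat.
by rewrite muln2 -addnn addnS addSn !ltnS leq_addr.
Qed.

End ScalarRates.

(** * Energy estimates along the inertial iteration *)

Lemma enorm_cvg0 {R : realType} {k : nat} (u : nat -> 'rV[R]_k) :
  u n @[n --> \oo] --> (0 : 'rV[R]_k) -> enorm (u n) @[n --> \oo] --> (0 : R).
Proof.
move=> u0; have h : Num.sqrt k%:R * `|u n| @[n --> \oo] --> (0 : R).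
  rewrite -[X in _ --> X](mulr0 (Num.sqrt k%:R)).
  by apply: cvgMl_tmp; apply/norm_cvg0P.
apply: squeeze_cvgr (cvg_cst 0) h.
by near=> n; rewrite enorm_ge0 enorm_le_norm.
Unshelve. all: by end_near. Qed.

(** The descent lemma at [u], with the gradient eliminated through [aE]. The coefficient of the
    cross term [dot a b] is c (2 + c' - 2 (1 + c') s L / 2), nonnegative by hypothesis, so 2 <a, b>
    <= |a|^2 + |b|^2 splits it evenly between the squares. *)
Lemma inertial_step {R : realType} {m : nat} (g : 'rV[R]_m -> R)
    (L s c c' : R) (u a b : 'rV[R]_m) :
  (forall z, differentiable g z) ->
  (forall z w, enorm (gradient g z - gradient g w) <= L * enorm (z - w)) ->
  0 < s -> 0 <= c -> 2 * (1 + c') * (s * L / 2) <= 2 + c' ->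
  a = c *: b - s *: gradient g u ->
  s * (g (u + ((1 + c') *: a - c *: b)) - g u) <=
    ((1 + c') * ((1 + c') * (s * L / 2) - 1) +
      c * (2 + c' - 2 * (1 + c') * (s * L / 2)) / 2) * enorm a ^+ 2 +
    (c ^+ 2 * (s * L / 2 - 1) +
      c * (2 + c' - 2 * (1 + c') * (s * L / 2)) / 2) * enorm b ^+ 2.
Proof.
move=> gd gL s0 c0 cl aE.
have := descent_lemma g L u ((1 + c') *: a - c *: b) gd gL.
have sG v : s * dot (gradient g u) v = c * dot b v - dot a v.
  by rewrite aE !dotE; ring.
move/(ler_wpM2l (ltW s0)); rewrite !mulrDr sG => h.
have p0 : 0 <= c * (2 + c' - 2 * (1 + c') * (s * L / 2)).
  by rewrite mulr_ge0// subr_ge0.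
have := ler_wpM2l p0 (dot_ge0 (a - b)).
move: h; set G := g (u + _).
rewrite !enorm_sqr !dotE (dotC b a).
set A := dot a a; set B := dot b b; set P := dot a b.
lra.
Qed.

Section InertialGradient.
Context {R : realType} {m : nat} (g : 'rV[R]_m -> R) (L alpha beta s : R).
Context (xbar : 'rV[R]_m) (x y : nat -> 'rV[R]_m).
Context (g_diff : forall z, differentiable g z) (L_ge0 : 0 <= L).
Context (g_lip : forall u v,
  enorm (gradient g u - gradient g v) <= L * enorm (u - v)).
Context (alpha_gt0 : 0 < alpha) (beta01 : 0 < beta < 1) (s_gt0 : 0 < s).
Context (s_lt : s * L < 2 * (1 - beta)).
Context (x_step : forall n : nat, x n.+1 = y n - s *: gradient g (y n)).
Context (y_step : forall n : nat, (1 <= n)%N ->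
  y n = x n + (beta * n%:R / (n%:R + alpha)) *: (x n - x n.-1)).
Context (x_cvg : x n @[n --> \oo] --> xbar).

Let gam (n : nat) : R := beta * n%:R / (n%:R + alpha).
(** The truncated predecessor makes [d 0] vanish; the recursions below start at index 1, where
    [y_step] begins. *)
Let d (n : nat) : 'rV[R]_m := x n - x n.-1.

Lemma inertia_bounds n : 0 <= gam n <= beta.
Proof.
have [b0 b1] := andP beta01.
have n0 : 0 < n%:R + alpha by rewrite ltr_wpDl.
rewrite /gam divr_ge0 ?mulr_ge0 ?(ltW b0) ?(ltW n0)//=.
by rewrite ler_pdivrMr// ler_pM2l// lerDl ltW.
Qed.

Lemma inertia_cvg : gam n @[n --> \oo] --> beta.
Proof.
have [b0 b1] := andP beta01.
apply/cvgrPdist_le => e e0; near=> n.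
have n0 : 0 < n%:R + alpha by rewrite ltr_wpDl.
have -> : beta - gam n = beta * alpha / (n%:R + alpha).
  by rewrite /gam; field; rewrite gt_eqF.
rewrite ger0_norm ?divr_ge0 ?mulr_ge0 ?(ltW n0) ?(ltW b0) ?(ltW alpha_gt0)//.
rewrite ler_pdivrMr// -ler_pdivrMl//.
apply: (@le_trans _ _ n%:R); last by rewrite lerDl ltW.
near: n; exact: nbhs_infty_ger.
Unshelve. all: by end_near. Qed.

Lemma x_pred_cvg : x n.-1 @[n --> \oo] --> xbar.
Proof. by rewrite -cvg_shiftS. Qed.

Lemma step_cvg0 : d n @[n --> \oo] --> (0 : 'rV[R]_m).
Proof. by rewrite -(subrr xbar); apply: cvgB => //; exact: x_pred_cvg. Qed.

Lemma y_cvg : y n @[n --> \oo] --> xbar.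
Proof.
have : x n + gam n *: d n @[n --> \oo] --> xbar.
  rewrite -[X in _ --> X]addr0 -(scaler0 _ beta).
  by apply: cvgD => //; apply: cvgZ; [exact: inertia_cvg|exact: step_cvg0].
apply: cvg_trans; apply: near_eq_cvg; near=> n.
by rewrite y_step//; near: n; exact: nbhs_infty_ge.
Unshelve. all: by end_near. Qed.

Lemma step_rec n : (1 <= n)%N ->
  d n.+1 = gam n *: d n - s *: gradient g (y n).
Proof. by move=> n1; rewrite /d x_step y_step// addrAC [x n + _]addrC addrK. Qed.

Lemma y_rec n : (1 <= n)%N ->
  y n.+1 = y n + ((1 + gam n.+1) *: d n.+1 - gam n *: d n).
Proof.
move=> n1; rewrite (y_step n.+1)// (y_step n)//.
by apply/rowP => i; rewrite !mxE -/(gam n) -/(gam n.+1) /=; ring.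
Qed.

(* For this weight the two squares |d_(n+1)|^2 and |d_n|^2 get the same
   coefficient in the limit, - (1 - beta - s L / 2) / (2 s). *)
Definition energy_weight : R :=
  (1 + beta - beta ^+ 2 - (1 + 2 * beta) * (s * L / 2)) / (2 * s).

(** Inserting s L / 2 <= 1 - beta bounds the numerator below by beta^2. *)
Lemma energy_weight_gt0 : 0 < energy_weight.
Proof.
have [b0 b1] := andP beta01.
rewrite divr_gt0 ?mulr_gt0//.
have sl : s * L / 2 <= 1 - beta by move: s_lt; lra.
have c0 : 0 <= 1 + 2 * beta by lra.
have b2 : 0 < beta ^+ 2 by rewrite exprn_gt0.
have := ler_wpM2l c0 sl; lra.
Qed.

Definition energy n : R := g (y n) + energy_weight * enorm (d n) ^+ 2.

Lemma energy_descent : exists2 c, 0 < c & \forall n \near \oo,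
  c * (enorm (d n.+1) ^+ 2 + enorm (d n) ^+ 2) <= energy n - energy n.+1.
Proof.
have [b0 b1] := andP beta01.
(* After multiplication by s both limiting coefficients equal -2 k; asking only for -k leaves room
   to pass from the limit to all large n. *)
pose l := s * L / 2; pose k := (1 - beta - l) / 4.
have l0 : 0 <= l by rewrite divr_ge0// mulr_ge0// ltW.
have k0 : 0 < k by move: s_lt; rewrite /k /l; lra.
exists (k / s); first by rewrite divr_gt0.
pose w := s * energy_weight.
have wE : w = (1 + beta - beta ^+ 2 - (1 + 2 * beta) * l) / 2.
  by rewrite /w /energy_weight -/l; field; rewrite gt_eqF.
pose B n := gam n * (2 + gam n.+1 - 2 * (1 + gam n.+1) * l) / 2.
pose A n := (1 + gam n.+1) * ((1 + gam n.+1) * l - 1).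
have gS : gam n.+1 @[n --> \oo] --> beta by rewrite cvg_shiftS; exact: inertia_cvg.
have g1 : 1 + gam n.+1 @[n --> \oo] --> 1 + beta.
  by apply: cvgD => //; exact: cvg_cst.
have cB : B n @[n --> \oo] --> beta * (2 + beta - 2 * (1 + beta) * l) / 2.
  apply: cvgMr_tmp; apply: cvgM; first exact: inertia_cvg.
  apply: cvgB; first by apply: cvgD => //; exact: cvg_cst.
  by apply: cvgMr_tmp; apply: cvgMl_tmp.
have cA : A n @[n --> \oo] --> (1 + beta) * ((1 + beta) * l - 1).
  by apply: cvgM => //; apply: cvgB; [exact: cvgMr_tmp|exact: cvg_cst].
have cC : gam n ^+ 2 * (l - 1) @[n --> \oo] --> beta ^+ 2 * (l - 1).
  by apply: cvgMr_tmp; rewrite expr2; apply: cvgM; exact: inertia_cvg.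
have nA : \forall n \near \oo, A n + B n <= - k - w.
  apply: (cvgr_le _ (cvgD cA cB)); move: k0; rewrite wE /k; lra.
have nC : \forall n \near \oo, gam n ^+ 2 * (l - 1) + B n <= - k + w.
  apply: (cvgr_le _ (cvgD cC cB)); move: k0; rewrite wE /k; lra.
near=> n.
have n1 : (1 <= n)%N by near: n; exact: nbhs_infty_ge.
have [gn0 gnb] := andP (inertia_bounds n).
have [gS0 gSb] := andP (inertia_bounds n.+1).
(* As l <= 1 - gam, the left side is at most 2 (1 - gam^2), with gam taken at n + 1. *)
have cl : 2 * (1 + gam n.+1) * l <= 2 + gam n.+1.
  have : l <= 1 - gam n.+1 by move: s_lt; rewrite /l; lra.
  have c0 : 0 <= 1 + gam n.+1 by lra.
  move=> /(ler_wpM2l c0); have := sqr_ge0 (gam n.+1); lra.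
have h1 := inertial_step g L s _ _ _ _ _ g_diff g_lip s_gt0 gn0 cl (step_rec n n1).
rewrite -y_rec// -/l -/(A n) -/(B n) in h1.
have hA : A n + B n <= - k - w by near: n.
have hC : gam n ^+ 2 * (l - 1) + B n <= - k + w by near: n.
have h2 := ler_wpM2r (sqr_ge0 (enorm (d n.+1))) hA.
have h3 := ler_wpM2r (sqr_ge0 (enorm (d n))) hC.
rewrite mulrAC ler_pdivrMr// /energy; move: h1 h2 h3.
set a2 := enorm (d n.+1) ^+ 2; set b2 := enorm (d n) ^+ 2.
rewrite /w; lra.
Unshelve. all: by end_near. Qed.

Lemma energy_cvg : energy n @[n --> \oo] --> g xbar.
Proof.
have -> : g xbar = g xbar + energy_weight * (0 * 0) by rewrite !mulr0 addr0.
apply: cvgD.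
  by apply: continuous_cvg; [exact: differentiable_continuous|exact: y_cvg].
have cd := enorm_cvg0 _ step_cvg0.
exact: cvgMl_tmp (cvgM cd cd).
Qed.

(** An eventually nonincreasing convergent sequence stays above its limit. *)
Lemma energy_ge_near : \forall n \near \oo, g xbar <= energy n.
Proof.
have [c c0 [N _ dec]] := energy_descent.
exists N => // n /= Nn.
have noninc : nonincreasing_seq (fun k => energy (n + k)%N).
  apply/nonincreasing_seqP => k; rewrite addnS -subr_ge0.
  apply: le_trans (dec _ _); last by rewrite /= (leq_trans Nn)// leq_addr.
  by rewrite mulr_ge0 ?addr_ge0 ?sqr_ge0// ltW.
have cv : energy (n + k)%N @[k --> \oo] --> g xbar.
  exact: (cvg_comp _ _ (cvg_addnl n) energy_cvg).
have := nonincreasing_cvgn_ge noninc (cvgP _ cv) 0.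
by rewrite (cvg_lim _ cv)// addn0.
Qed.

Lemma energy_lojasiewicz theta :
  lojasiewicz_at (regularization g) (row_mx xbar xbar) theta ->
  exists2 C, 0 < C & \forall n \near \oo,
    (energy n - g xbar) `^ theta <= C * (enorm (d n.+1) + enorm (d n)).
Proof.
move=> [_ _ _ [K [eps [K0 eps0 loja]]]].
have [b0 b1] := andP beta01.
(* Chosen so that the quadratic term of the regularization at [z n] is exactly the weighted square
   in the energy. *)
pose mu := Num.sqrt (2 * energy_weight).
have mu0 : 0 <= mu by exact: sqrtr_ge0.
have mu2 : mu ^+ 2 = 2 * energy_weight.
  by rewrite sqr_sqrtr// mulr_ge0// ltW// energy_weight_gt0.
have si0 : 0 < s^-1 by rewrite invr_gt0.
(* The gradient at [z n] has blocks grad g(y_n) - mu d_n and mu d_n, which gives 2 mu; solving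
   [step_rec] for grad g(y_n) gives the [s^-1]. *)
exists (K * (s^-1 + 2 * mu)); first by rewrite mulr_gt0// ltr_pwDl// mulr_ge0.
pose z n := row_mx (y n) (y n + mu *: d n).
have near_z : \forall n \near \oo,
    2 * enorm (y n - xbar) + mu * enorm (d n) < eps.
  have cy : enorm (y n - xbar) @[n --> \oo] --> (0 : R).
    by apply: enorm_cvg0; rewrite -(subrr xbar); apply: cvgB;
      [exact: y_cvg|exact: cvg_cst].
  have cd : enorm (d n) @[n --> \oo] --> (0 : R).
    by apply: enorm_cvg0; exact: step_cvg0.
  apply: (cvgr_lt _ (cvgD (cvgMl_tmp (a := 2) cy) (cvgMl_tmp (a := mu) cd))).
  by rewrite !mulr0 addr0.
near=> n.
have n1 : (1 <= n)%N by near: n; exact: nbhs_infty_ge.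
have Hz : regularization g (z n) = energy n.
  rewrite /regularization row_mxKl row_mxKr /energy.
  rewrite opprD addNKr enormN enormZ ger0_norm// exprMn mu2.
  by congr +%R; rewrite mulrA mulKf.
have Hb : regularization g (row_mx xbar xbar) = g xbar.
  rewrite /regularization row_mxKl row_mxKr subrr enorm_sqr dot0l.
  by rewrite mulr0 addr0.
have zeps : enorm (z n - row_mx xbar xbar) < eps.
  rewrite opp_row_mx add_row_mx.
  apply: le_lt_trans (enorm_row_mx _ _) _.
  rewrite addrAC.
  have := ler_enormD (y n - xbar) (mu *: d n).
  rewrite enormZ ger0_norm//.
  have : 2 * enorm (y n - xbar) + mu * enorm (d n) < eps by near: n.
  lra.
have := loja _ zeps; rewrite Hz Hb.
rewrite ger0_norm; last first.
  by rewrite subr_ge0; near: n; exact: energy_ge_near.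
move=> /le_trans; apply.
rewrite -mulrA ler_pM2l// gradient_regularization//.
apply: le_trans (enorm_row_mx _ _) _.
rewrite opprD addNKr [_ - y n]addrAC subrr add0r.
have := ler_enormB (gradient g (y n)) (mu *: d n).
rewrite enormZ ger0_norm//.
have gE : gradient g (y n) = s^-1 *: (gam n *: d n - d n.+1).
  by rewrite step_rec// opprB addrC subrK scalerA mulVf ?gt_eqF// scale1r.
have [gn0 gnb] := andP (inertia_bounds n).
have := ler_enormB (gam n *: d n) (d n.+1).
rewrite enormZ ger0_norm// => h1 h2.
have h3 : enorm (gradient g (y n)) <= s^-1 * (enorm (d n.+1) + enorm (d n)).
  rewrite gE enormZ ger0_norm ?(ltW si0)// ler_pM2l//.
  apply: le_trans h1 _; rewrite addrC lerD2l ler_piMl ?enorm_ge0//.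
  by rewrite (le_trans gnb)// ltW.
have := mulr_ge0 mu0 (enorm_ge0 (d n.+1)).
lra.
Unshelve. all: by end_near. Qed.

End InertialGradient.

(** * From the energy to the iterates *)

Lemma gradient_step_decreases {R : realType} {m : nat} (g : 'rV[R]_m -> R)
    (L s : R) (u : 'rV[R]_m) :
  (forall z, differentiable g z) ->
  (forall z w, enorm (gradient g z - gradient g w) <= L * enorm (z - w)) ->
  0 <= s -> s * L <= 2 -> g (u - s *: gradient g u) <= g u.
Proof.
move=> gd gL s0 sL.
have := descent_lemma g L u (- (s *: gradient g u)) gd gL.
rewrite !dotE => /le_trans; apply.
rewrite -addrA gerDl.
(* The remaining terms add up to - s (1 - s L / 2) |grad g(u)|^2. *)
have : 0 <= (s * dot (gradient g u) (gradient g u)) * (2 - s * L).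
  by rewrite mulr_ge0 ?subr_ge0// mulr_ge0// dot_ge0.
lra.
Qed.

(** Telescoping bounds the distance from x_n to every later term by [phi n], and this bound survives
    the limit. *)
Lemma length_to_limit {R : realType} {m : nat} (x : nat -> 'rV[R]_m)
    (xbar : 'rV[R]_m) (phi : nat -> R) (N : nat) :
  x n @[n --> \oo] --> xbar -> (forall n, 0 <= phi n) ->
  (forall n, (N <= n)%N -> enorm (x n.+1 - x n) <= phi n - phi n.+1) ->
  forall n, (N <= n)%N -> enorm (x n - xbar) <= phi n.
Proof.
move=> xc phi0 step n Nn.
have len j : enorm (x n - x (n + j)%N) <= phi n - phi (n + j)%N.
  elim: j => [|j ih]; first by rewrite addn0 !subrr enorm0.
  rewrite addnS -(subrKA (x (n + j)%N)).
  apply: le_trans (ler_enormD _ _) _.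
  rewrite -(enormN (x (n + j)%N - _)) opprB.
  have := step (n + j)%N (leq_trans Nn (leq_addr _ _)); lra.
apply/ler_addgt0Pr => e e0.
have ex : enorm (x k - xbar) @[k --> \oo] --> (0 : R).
  by apply: enorm_cvg0; rewrite -(subrr xbar); apply: cvgB => //; exact: cvg_cst.
have [M _ xM] := cvgr_lt _ ex _ e0.
have := xM (n + M)%N (leq_addl _ _).
have := len M; have := phi0 (n + M)%N.
rewrite -[x n - xbar](subrKA (x (n + M)%N)).
have := ler_enormD (x n - x (n + M)%N) (x (n + M)%N - xbar).
lra.
Qed.

Theorem theorem15 (R : realType) (m : nat) (g : 'rV[R]_m -> R)
  (Lg alpha beta s theta : R) (x0 xbar : 'rV[R]_m) (x y : nat -> 'rV[R]_m)
  (g_diff : forall z, differentiable g z)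
  (Lg_ge0 : 0 <= Lg)
  (g_lip : forall u v,
     enorm (gradient g u - gradient g v) <= Lg * enorm (u - v))
  (g_bnd : exists c : R, forall z, c <= g z)
  (alpha_gt0 : 0 < alpha)
  (beta01 : 0 < beta < 1)
  (s_gt0 : 0 < s)
  (s_lt : s * Lg < 2 * (1 - beta))
  (x_init : x 0%N = x0)
  (y_init : y 0%N = x0)
  (x_step : forall n : nat, x n.+1 = y n - s *: gradient g (y n))
  (y_step : forall n : nat, (1 <= n)%N ->
     y n = x n + (beta * n%:R / (n%:R + alpha)) *: (x n - x n.-1))
  (x_bnd : exists M : R, forall n : nat, enorm (x n) <= M)
  (xbar_crit : crit g xbar)
  (x_cvg : x n @[n --> \oo] --> xbar)
  (theta_bnd : 2^-1 < theta < 1)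
  (H_loja : lojasiewicz_at (regularization g) (row_mx xbar xbar) theta) :
  exists (b1 b2 b3 b4 : R) (N1 : nat),
    [/\ 0 < b1, 0 < b2, 0 < b3 & 0 < b4] /\
    [/\ forall n : nat, (N1 + 2 <= n)%N ->
          g (y n) - g xbar <= b1 * (1 / n%:R `^ (1 / (2 * theta - 1))),
        forall n : nat, (N1 + 2 <= n)%N ->
          g (x n) - g xbar <= b2 * (1 / n%:R `^ (1 / (2 * theta - 1))),
        forall n : nat, (N1 + 2 <= n)%N ->
          enorm (x n - xbar) <=
            b3 * (1 / n%:R `^ ((1 - theta) / (2 * theta - 1))) &
        forall n : nat, (N1 + 2 < n)%N ->
          enorm (y n - xbar) <=
            b4 * (1 / n%:R `^ ((1 - theta) / (2 * theta - 1)))].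
Proof.
have [b0 b1] := andP beta01.
have [th2 th1] := andP theta_bnd.
have [c c0 dec] := energy_descent g Lg alpha beta s x y g_diff Lg_ge0
  g_lip alpha_gt0 beta01 s_gt0 s_lt x_step y_step.
have rge := energy_ge_near g Lg alpha beta s xbar x y g_diff Lg_ge0
  g_lip alpha_gt0 beta01 s_gt0 s_lt x_step y_step x_cvg.
have [C C0 KL] := energy_lojasiewicz g Lg alpha beta s xbar x y g_diff Lg_ge0
  g_lip alpha_gt0 beta01 s_gt0 s_lt x_step y_step x_cvg theta H_loja.
have [N _ PN] := filterI (filterI dec rge) KL.
pose e n := enorm (x n - x n.-1).
pose r n := energy g Lg beta s x y n - g xbar.
have e0 n : 0 <= e n by exact: enorm_ge0.
have r0 n : (N <= n)%N -> 0 <= r n.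
  by move=> /PN[[_ h] _]; rewrite subr_ge0.
have rS n : (N <= n)%N -> c * (e n.+1 ^+ 2 + e n ^+ 2) <= r n - r n.+1.
  by move=> /PN[[h _] _]; rewrite /r opprB addrA subrK.
have rKL n : (N <= n)%N -> r n `^ theta <= C * (e n.+1 + e n).
  by move=> /PN[_ h].
have [b bp rb] := kl_descent_rate r e c C theta N theta_bnd c0 C0 e0 r0 rS rKL.
have th01 : 0 < theta < 1 by lra.
pose k := (1 - theta) * (c / (2 * C)).
have k0 : 0 < k by rewrite mulr_gt0 ?subr_gt0// divr_gt0// mulr_gt0.
have len n : (N <= n)%N -> enorm (x n - xbar) <= k^-1 * r n `^ (1 - theta).
  (* [kl_descent_length] controls two consecutive increments; dropping the nonnegative [e n] leaves
     the step from n to n + 1. *)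
  move=> Nn; apply: (@length_to_limit _ _ _ _
    (fun n => k^-1 * r n `^ (1 - theta)) N) => // {n Nn} n.
    by rewrite mulr_ge0 ?powR_ge0// invr_ge0 ltW.
  move=> Nn; rewrite -mulrBr ler_pdivlMl//.
  have := @kl_descent_length _ r e c C theta N th01 c0 C0 e0 r0 rS rKL n Nn.
  apply: le_trans; rewrite ler_pM2l// -/(e n.+1) lerDl.
  exact: e0.
pose q := (2 * theta - 1)^-1; pose q' := (1 - theta) / (2 * theta - 1).
have q0 : 0 <= q by rewrite invr_ge0; lra.
have q'0 : 0 <= q' by rewrite divr_ge0; lra.
pose b' := k^-1 * b `^ (1 - theta).
have b'0 : 0 < b' by rewrite mulr_gt0 ?invr_gt0// powR_gt0.
have yE n : (N <= n)%N -> g (y n) - g xbar <= r n.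
  move=> Nn; rewrite lerD2r /energy lerDl mulr_ge0 ?sqr_ge0// ltW//.
  exact: energy_weight_gt0.
have leN n : (2 * N < n)%N -> (N <= n)%N.
  by move=> /ltnW; apply: leq_trans; rewrite leq_pmull.
have xb n : (2 * N < n)%N -> enorm (x n - xbar) <= b' * n%:R `^ (- q').
  move=> Nn.
  apply: le_trans (len _ (leN _ Nn)) _; rewrite -mulrA ler_pM2l ?invr_gt0//.
  have -> : - q' = - q * (1 - theta) by rewrite /q' /q; ring.
  rewrite powRrM -powRM ?powR_ge0 ?(ltW bp)//.
  have rn0 := r0 _ (leN _ Nn).
  have q1 : 0 <= 1 - theta by rewrite subr_ge0 ltW.
  rewrite ge0_ler_powR ?nnegrE ?rb//.
  by rewrite mulr_ge0 ?powR_ge0 ?(ltW bp).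
(* With N1 = 2 N, n >= N1 + 2 still gives n - 1 > 2 N, so estimates at n - 1 apply; the powers of 2
   pay for returning to n. The last constant comes from |y_n - xbar| <= 2 |x_n - xbar| + |x_(n-1) -
   xbar|. *)
exists b, (b * 2 `^ q), b', (2 * b' + b' * 2 `^ q'), (2 * N)%N.
have p2 z : 0 < 2 `^ z :> R by rewrite powR_gt0.
split; first by split=> //; [exact: mulr_gt0|apply: addr_gt0; exact: mulr_gt0].
rewrite div1r -/q -/q'.
have E (n : nat) z : 1 / n%:R `^ z = n%:R `^ (- z) :> R by rewrite powRN div1r.
split => n; rewrite E.
- rewrite addn2 => /ltnW Nn.
  exact: le_trans (yE _ (leN _ Nn)) (rb _ Nn).
(* Indices 0 and 1 lie below the threshold; beyond it, x_n is a gradient step from y_(n-1) and does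
   not increase g. *)
- case: n => [|[|n]]; rewrite addn2// => Nn.
  apply: (@le_trans _ _ (g (y n.+1) - g xbar)).
    rewrite lerD2r x_step (gradient_step_decreases g Lg)// ?ltW//; lra.
  apply: le_trans (yE _ (leN n.+1 Nn)) _.
  apply: le_trans (rb n.+1 Nn) _.
  by rewrite -mulrA ler_pM2l// powR_succ_le.
- by rewrite addn2 => /ltnW; exact: xb.
- case: n => [|[|n]]; rewrite addn2// => /ltnW Nn.
  have h1 := xb n.+2 (ltnW Nn).
  have h2 := le_trans (xb n.+1 Nn) (ler_wpM2l (ltW b'0) (powR_succ_le n _ q'0)).
  have [g0 gb] := andP (inertia_bounds alpha beta alpha_gt0 beta01 n.+2).
  rewrite y_step// addrAC.
  have := ler_enormD (x n.+2 - xbar)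
    ((beta * n.+2%:R / (n.+2%:R + alpha)) *: (x n.+2 - x n.+1)).
  rewrite enormZ ger0_norm// => h3.
  have h4 := ler_enormB (x n.+2 - xbar) (x n.+1 - xbar).
  rewrite opprB addrA subrK in h4.
  have h5 := ler_piMl (enorm_ge0 (x n.+2 - x n.+1)) (le_trans gb (ltW b1)).
  lra.
Qed.
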